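(* Let $0<\alpha<1$ and let $n\in\mathbb{N}$ satisfy $n^{1-\alpha}>2$. Let $f\in C_B(\mathbb{R})$. Then for every $x\in\mathbb{R}$ $$\left|A_n^*(f)(x)-f(x)\right|\le \omega\!\left(f,\frac1n+\frac{1}{n^{\alpha}}\right)+\frac{2\left(q+\frac1q\right)\|f\|_\infty}{B^{\beta(n^{1-\alpha}-1)}}=:E,$$ and $$\|A_n^*(f)-f\|_\infty\le E.$$ Furthermore, if $f\in C_{UB}(\mathbb{R})$, then $\lim_{n\to\infty}A_n^*(f)=f$ pointwise and uniformly on $\mathbb{R}$.
   Context: Fix real parameters $q>0$, $\beta>0$, $B>1$; $\mathbb{N}=\{1,2,3,\dots\}$. For $x\in\mathbb{R}$ and any $p>0$ put $$\nu_{p,\beta}(x)=\frac{1}{1+pB^{-\beta x}},\qquad G_{p,\beta}(x)=\tfrac12\big(\nu_{p,\beta}(x+1)-\nu_{p,\beta}(x-1)\big),\qquad \Psi(x)=\tfrac12\big(G_{q,\beta}(x)+G_{1/q,\beta}(x)\big).$$ $C_B(\mathbb{R})$ is the set of continuous bounded functions $f:\mathbb{R}\to\mathbb{R}$; $C_{UB}(\mathbb{R})$ is the set of uniformly continuous bounded functions on $\mathbb{R}$; $\|\cdot\|_\infty$ is the supremum norm on $\mathbb{R}$. The modulus of continuity is $\omega(f,\theta)=\sup\{|f(x)-f(y)|: x,y\in\mathbb{R},\ |x-y|\le\theta\}$ for $\theta>0$. For $n\in\mathbb{N}$ the Kantorovich type operator $A_n^*$ is $$A_n^*(f)(x)=n\int_{-\infty}^{\infty}\left(\int_{v/n}^{(v+1)/n}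 f(h)\,dh\right)\Psi(nx-v)\,dv=n\int_{-\infty}^{\infty}\left(\int_0^{1/n} f\!\left(h+\frac vn\right)dh\right)\Psi(nx-v)\,dv .$$ *)

(* Defs.v *)
From mathcomp Require Import all_boot all_order all_algebra.
From mathcomp Require Import all_classical all_reals all_analysis.

Set Implicit Arguments.
Unset Strict Implicit.
Unset Printing Implicit Defensive.

Import Order.TTheory GRing.Theory Num.Theory.
Import numFieldNormedType.Exports.

Local Open Scope classical_set_scope.
Local Open Scope ring_scope.

Section Kantorovich.
Context {R : realType}.
Implicit Types (p q beta B x theta : R) (f : R -> R) (n : nat).

Definition nu p beta B x : R := (1 + p * B `^ (- (beta * x)))^-1.

Definition G p beta B x : R :=
  2^-1 * (nu p beta B (x + 1) - nu p beta B (x - 1)).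

Definition Psi q beta B x : R := 2^-1 * (G q beta B x + G q^-1 beta B x).

Definition C_B f : Prop := continuous f /\ bounded_fun f.

Definition C_UB f : Prop := unif_continuous f /\ bounded_fun f.

(* [sup] is the supremum in [R], which is 0 by convention on a set that is not
   bounded above; the two definitions below have their usual meaning on bounded
   functions. *)
Definition supnorm f : R := sup [set `|f x| | x in [set: R]].

Definition modulus f theta : R :=
  sup [set d | exists x y : R, `|x - y| <= theta /\ d = `|f x - f y|].

(* Both integrals are Lebesgue integrals; for [f] in [C_B] the integrands are
   integrable. The operator is meant for [0 < n]. *)
Definition Kantorovich q beta B n f x : R :=
  n%:R * \int[lebesgue_measure]_(v in [set: R])
    ((\int[lebesgue_measure]_(h in `[v / n%:R, (v + 1) / n%:R]) f h)
     * Psi q beta B (n%:R * x - v)).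

End Kantorovich.

(* Main.v *)
(* Write c = beta ln B. The sigmoid nu_p has the primitive
   L_p(x) = ln (e^(cx) + p) / c, so Psi has the primitive
   P = (W_q + W_(1/q)) / 4 with W_p(x) = L_p(x + 1) - L_p(x - 1). The bounds
   ln t <= t - 1 and 1 - e^(-2c) <= 2c give W_p(x) <= (2/p) e^(c(x+1)) and
   2 - W_p(x) <= 2 p e^(-c(x-1)). Hence Psi has total mass 1, and its mass
   outside ]-N, N[ is at most (q + 1/q) B^(-beta(N-1)). Averaging
   |f(h) - f(x)| against the probability density v |-> Psi(nx - v), the part
   |nx - v| < N contributes at most the oscillation of f at distance
   1/n + N/n, and the rest at most 2 ||f|| times the tail mass. Take
   N = n^(1-alpha) for the estimate, and N proportional to n for the uniform
   convergence. *)
Require Import Defs.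
From mathcomp Require Import all_boot all_order all_algebra.
From mathcomp Require Import all_classical all_reals all_analysis.
From mathcomp Require Import measurable_realfun ring lra.
Import Order.TTheory GRing.Theory Num.Theory.
Import numFieldNormedType.Exports.
Local Open Scope classical_set_scope.
Local Open Scope ring_scope.

(** * Half-line integrals of nonnegative functions from a primitive *)

Lemma ge0_integral_primitivey {R : realType} (g Q : R -> R) (a l : R) :
    (forall x, 0 <= g x) -> continuous g ->
    (forall x : R, is_derive x (1 : R) Q (g x)) -> Q x @[x --> +oo%R] --> l ->
  (\int[lebesgue_measure]_(x in `[a, +oo[) (g x)%:E = (l - Q a)%:E)%E.
Proof.
move=> g0 cg dQ Ql.
have cQ : continuous Q.
  by move=> x; apply/differentiable_continuous/derivable1_diffP; case: (dQ x).
rewrite (@ge0_continuous_FTC2y _ g Q a l) ?EFinB//.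
- exact: continuous_subspaceT.
- exact/cvg_at_right_filter/cQ.
- by move=> x _; rewrite derive1E; case: (dQ x).
Qed.

(** The reflection x |-> -x carries this to the right half-line, where [g (- x)] has the primitive
    [- Q (- x)]. *)
Lemma ge0_integral_primitiveNy {R : realType} (g Q : R -> R) (a l : R) :
    (forall x, 0 <= g x) -> continuous g ->
    (forall x : R, is_derive x (1 : R) Q (g x)) -> Q x @[x --> -oo%R] --> l ->
  (\int[lebesgue_measure]_(x in `]-oo, a]) (g x)%:E = (Q a - l)%:E)%E.
Proof.
move=> g0 cg dQ Ql.
rewrite -[a]opprK ge0_integration_by_substitutionNy//; last first.
  exact: continuous_subspaceT.
have -> : (Q (- - a) - l = - l - - Q (- - a))%R by ring.
apply: (@ge0_integral_primitivey R (g \o -%R) (fun x => - Q (- x)) (- a) (- l)).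
- by move=> x; exact: g0.
- by move=> x; apply: continuous_comp; [exact: opp_continuous|exact: cg].
- move=> x; have dQx := dQ (- x).
  by apply: is_derive_eq; rewrite /GRing.scale /=; ring.
- by apply: cvgN; exact/cvgNy_compNP.
Qed.

(** * The sigmoid, the density [Psi] and their primitives *)

Lemma powR_expR {R : realType} (B x : R) : 0 < B -> B `^ x = expR (x * ln B).
Proof. by move=> B0; rewrite /powR gt_eqF. Qed.

Definition nu_primitive {R : realType} (c p x : R) : R :=
  ln (expR (c * x) + p) / c.

(** For c = beta ln B this is the distribution function of the density [Psi]: it rises from 0 to 1.
    The factor 1/4 collects the halves in [G] and in [Psi]. *)
Definition Psi_primitive {R : realType} (c q x : R) : R :=
  4^-1 * (nu_primitive c q (x + 1) - nu_primitive c q (x - 1) +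
          (nu_primitive c q^-1 (x + 1) - nu_primitive c q^-1 (x - 1))).

Section Psi_theory.
Context {R : realType}.
Implicit Types (p q beta B c x y : R).

(** Multiplying through by e^(cx), with c = beta ln B, makes the sigmoid a logarithmic derivative up
    to the factor c; the primitive is read off from this form. *)
Lemma nu_expR p beta B x : 0 < B -> 0 < p ->
  nu p beta B x = expR (beta * ln B * x) / (expR (beta * ln B * x) + p).
Proof.
move=> B0 p0; rewrite /nu powR_expR//.
have -> : - (beta * x) * ln B = - (beta * ln B * x) by ring.
have e0 := expR_gt0 (beta * ln B * x).
rewrite expRN; field.
by rewrite !gt_eqF ?addr_gt0 ?divr_gt0//.
Qed.

Lemma nu_le p beta B x y : 1 < B -> 0 < beta -> 0 < p -> x <= y ->
  nu p beta B x <= nu p beta B y.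
Proof.
move=> B1 beta0 p0 xy; have B0 : 0 < B by exact: lt_trans B1.
rewrite /nu lef_pV2 ?posrE ?addr_gt0 ?mulr_gt0 ?powR_gt0//.
by rewrite lerD2l ler_pM2l//; apply: ler_powR;
  rewrite ?(ltW B1)// lerN2 ler_pM2l.
Qed.

Lemma nu_continuous p beta B : 0 < B -> 0 < p -> continuous (nu p beta B).
Proof.
move=> B0 p0 x.
have -> : nu p beta B =
    fun x => expR (beta * ln B * x) / (expR (beta * ln B * x) + p).
  by apply/funext => z; rewrite nu_expR.
have cE : {for x, continuous (fun x => expR (beta * ln B * x))}.
  apply: continuous_comp; last exact: continuous_expR.
  exact: mulrl_continuous.
apply: cvgM => //; apply: cvgV; first by rewrite gt_eqF ?addr_gt0 ?expR_gt0.
by apply: cvgD => //; exact: cvg_cst.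
Qed.

Lemma is_derive_nu_primitive c p x : 0 < c -> 0 < p ->
  is_derive x (1 : R) (nu_primitive c p) (expR (c * x) / (expR (c * x) + p)).
Proof.
move=> c0 p0.
have e0 := expR_gt0 (c * x).
have dln : is_derive (expR (c * x) + p) (1 : R) (@ln R) (expR (c * x) + p)^-1.
  by apply: is_derive1_ln; rewrite addr_gt0.
have dE : is_derive x (1 : R) (fun x => expR (c * x)) (expR (c * x) * c).
  apply: (@is_derive1_comp _ (@expR R) (fun x => c * x)).
  by apply: is_derive_eq; rewrite /GRing.scale /= mulr1.
have dD : is_derive x (1 : R) (fun x => expR (c * x) + p) (expR (c * x) * c).
  by apply: is_derive_eq; rewrite addr0.
have dC := @is_derive1_comp _ (@ln R) (fun x => expR (c * x) + p) x _ _ dln dD.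
rewrite /nu_primitive.
have -> : (fun z => ln (expR (c * z) + p) / c) =
    (@ln R \o (fun x => expR (c * x) + p)) * cst c^-1.
  by apply/funext.
apply: is_derive_eq; rewrite /GRing.scale /=; field.
by rewrite !gt_eqF ?addr_gt0.
Qed.

Lemma Psi_ge0 q beta B x : 0 < q -> 0 < beta -> 1 < B -> 0 <= Psi q beta B x.
Proof.
move=> q0 b0 B1; rewrite /Psi /G mulr_ge0 ?invr_ge0//.
rewrite addr_ge0// mulr_ge0 ?invr_ge0//.
  by rewrite subr_ge0 nu_le//; lra.
by rewrite subr_ge0 nu_le ?invr_gt0//; lra.
Qed.

Lemma Psi_continuous q beta B : 0 < q -> 0 < B -> continuous (Psi q beta B).
Proof.
move=> q0 B0 x.
have cnu p a : 0 < p -> {for x, continuous (fun x => nu p beta B (x + a))}.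
  move=> p0; apply: continuous_comp; last exact: nu_continuous.
  by apply: cvgD; [exact: cvg_id|exact: cvg_cst].
have qV0 : 0 < q^-1 by rewrite invr_gt0.
by apply: cvgM; [exact: cvg_cst|apply: cvgD];
  apply: cvgM; (try exact: cvg_cst); apply: cvgB; exact: cnu.
Qed.

Lemma is_derive_Psi_primitive q beta B x : 0 < q -> 0 < beta -> 1 < B ->
  is_derive x (1 : R) (Psi_primitive (beta * ln B) q) (Psi q beta B x).
Proof.
move=> q0 b0 B1; have c0 : 0 < beta * ln B by rewrite mulr_gt0 ?ln_gt0.
have B0 : 0 < B by exact: lt_trans B1.
have d p a : 0 < p -> is_derive x (1 : R)
    (fun x => nu_primitive (beta * ln B) p (x + a)) (nu p beta B (x + a)).
  move=> p0; have dx := is_derive_nu_primitive _ _ (x + a) c0 p0.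
  have := @is_derive1_comp _ (nu_primitive (beta * ln B) p)
    (fun x => x + a) x _ 1 dx.
  by rewrite mulr1 nu_expR//; apply; apply: is_derive_eq; rewrite addr0.
have qV0 : 0 < q^-1 by rewrite invr_gt0.
have d1 := d q 1 q0; have d2 := d q (-1) q0.
have d3 := d _ 1 qV0; have d4 := d _ (-1) qV0.
rewrite /Psi_primitive; apply: is_derive_eq.
by rewrite /GRing.scale /= /Psi /G; field.
Qed.

Lemma ln_le_subr1 x : 0 < x -> ln x <= x - 1.
Proof.
move=> x0; rewrite -[x in ln x](@addrNK _ 1) addrC; apply: le_ln1Dx; lra.
Qed.

Lemma nu_primitive_increment_ge0 c p x : 0 < c -> 0 < p ->
  0 <= nu_primitive c p (x + 1) - nu_primitive c p (x - 1).
Proof.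
move=> c0 p0; rewrite /nu_primitive -mulrBl divr_ge0 ?(ltW c0)// subr_ge0.
rewrite ler_ln ?posrE ?addr_gt0 ?expR_gt0// lerD2r ler_expR ler_pM2l//; lra.
Qed.

(** Controls the left tail. The increment times c is ln((b + p)/(a + p)) <= (b - a)/p, and a = b
    e^(-2c) gives b - a <= 2cb; the factor c then cancels, so the constant 2/p does not depend on
    c. *)
Lemma nu_primitive_increment_le c p x : 0 < c -> 0 < p ->
  nu_primitive c p (x + 1) - nu_primitive c p (x - 1) <=
  2 * p^-1 * expR (c * (x + 1)).
Proof.
move=> c0 p0; rewrite /nu_primitive -mulrBl ler_pdivrMr//.
set b := expR (c * (x + 1)); set a := expR (c * (x - 1)).
have a0 : 0 < a := expR_gt0 _; have b0 : 0 < b := expR_gt0 _.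
rewrite -ln_div ?posrE ?addr_gt0//.
apply: le_trans (ln_le_subr1 _ _) _; first by rewrite divr_gt0 ?addr_gt0.
have -> : (b + p) / (a + p) - 1 = (b - a) / (a + p).
  by field; rewrite gt_eqF ?addr_gt0.
have ab : b * (1 - 2 * c) <= a.
  have -> : a = b * expR (- (2 * c)) by rewrite -expRD; congr expR; ring.
  by rewrite ler_pM2l// (expR_ge1Dx (- (2 * c))).
have ba : a <= b by rewrite ler_expR ler_pM2l//; lra.
apply: (@le_trans _ _ ((b - a) / p)).
  by rewrite ler_wpM2l ?subr_ge0// lef_pV2 ?posrE ?addr_gt0// lerDr ltW.
have -> : 2 * p^-1 * b * c = (b * 2 * c) / p by ring.
by rewrite ler_pM2r ?invr_gt0//; lra.
Qed.

(** Controls the right tail. Writing 2c as ln u with u = b/a turns the deficit times c into a single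
    logarithm, at most p(u - 1)/b; then u - 1 <= 2cu, and u cancels against b = ua. *)
Lemma nu_primitive_increment_ge c p x : 0 < c -> 0 < p ->
  2 - (nu_primitive c p (x + 1) - nu_primitive c p (x - 1)) <=
  2 * p * expR (- (c * (x - 1))).
Proof.
move=> c0 p0; rewrite -(ler_pM2r c0) /nu_primitive.
rewrite [in leLHS]mulrBl mulrBl !divfK ?gt_eqF//.
set b := expR (c * (x + 1)); set a := expR (c * (x - 1)).
have a0 : 0 < a := expR_gt0 _; have b0 : 0 < b := expR_gt0 _.
set u := expR (2 * c); have u0 : 0 < u := expR_gt0 _.
have bE : b = u * a by rewrite -expRD; congr expR; ring.
rewrite opprB -ln_div ?posrE ?addr_gt0// -[2 * c]expRK -/u.
rewrite -lnM ?posrE ?divr_gt0 ?addr_gt0//.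
apply: le_trans (ln_le_subr1 _ _) _.
  by rewrite mulr_gt0 ?divr_gt0 ?addr_gt0.
have -> : u * ((a + p) / (b + p)) - 1 = p * (u - 1) / (b + p).
  by rewrite bE; field; rewrite gt_eqF ?addr_gt0 ?mulr_gt0.
have u1 : 1 <= u by rewrite -expR0 ler_expR; lra.
have uc : u * (1 - 2 * c) <= 1.
  rewrite [leRHS](_ : 1 = u * expR (- (2 * c)));
    last by rewrite -expRD subrr expR0.
  by rewrite ler_pM2l// (expR_ge1Dx (- (2 * c))).
apply: (@le_trans _ _ (p * (u - 1) / b)).
  rewrite ler_wpM2l ?mulr_ge0 ?subr_ge0 ?(ltW p0)//.
  by rewrite lef_pV2 ?posrE ?addr_gt0// lerDl ltW.
rewrite expRN -/a ler_pdivrMr// bE.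
have -> : 2 * p * a^-1 * c * (u * a) = p * (2 * u * c).
  by field; rewrite gt_eqF.
by rewrite ler_pM2l//; lra.
Qed.

(** The primitive has slope at most 1 and the interval has length 2; in exponential form, b + p <=
    e^(2c) (a + p). *)
Lemma nu_primitive_increment_le2 c p x : 0 < c -> 0 < p ->
  nu_primitive c p (x + 1) - nu_primitive c p (x - 1) <= 2.
Proof.
move=> c0 p0; rewrite /nu_primitive -mulrBl ler_pdivrMr// lerBlDr.
rewrite -[2 * c]expRK -lnM ?posrE ?addr_gt0 ?expR_gt0//.
rewrite ler_ln ?posrE ?mulr_gt0 ?addr_gt0 ?expR_gt0// [leRHS]mulrDr -expRD.
have -> : 2 * c + c * (x - 1) = c * (x + 1) by ring.
rewrite lerD2l ler_peMl ?(ltW p0)//; have := expR_ge1Dx (2 * c); lra.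
Qed.

Lemma Psi_primitive_le1 c q x : 0 < c -> 0 < q -> Psi_primitive c q x <= 1.
Proof.
move=> c0 q0; have qV0 : 0 < q^-1 by rewrite invr_gt0.
have := nu_primitive_increment_le2 c q x c0 q0.
have := nu_primitive_increment_le2 c q^-1 x c0 qV0.
by rewrite /Psi_primitive; lra.
Qed.

Lemma Psi_primitive_ge0 c q x : 0 < c -> 0 < q -> 0 <= Psi_primitive c q x.
Proof.
by move=> c0 q0; rewrite mulr_ge0 ?invr_ge0// addr_ge0//
  nu_primitive_increment_ge0 ?invr_gt0.
Qed.

(** The parameters q and 1/q contribute 2/q and 2q, in the opposite order for the right tail.
    Pairing them thus gives both tails the same constant. *)
Lemma Psi_primitive_le c q x : 0 < c -> 0 < q ->
  Psi_primitive c q x <= (q + q^-1) / 2 * expR (c * (x + 1)).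
Proof.
move=> c0 q0; have qV0 : 0 < q^-1 by rewrite invr_gt0.
have := nu_primitive_increment_le c q x c0 q0.
have := nu_primitive_increment_le c q^-1 x c0 qV0.
by rewrite /Psi_primitive invrK; lra.
Qed.

Lemma Psi_primitive_ge c q x : 0 < c -> 0 < q ->
  1 - Psi_primitive c q x <= (q + q^-1) / 2 * expR (- (c * (x - 1))).
Proof.
move=> c0 q0; have qV0 : 0 < q^-1 by rewrite invr_gt0.
have := nu_primitive_increment_ge c q x c0 q0.
have := nu_primitive_increment_ge c q^-1 x c0 qV0.
by rewrite /Psi_primitive; lra.
Qed.

End Psi_theory.

(** * The kernel v |-> Psi(y - v) as a probability density *)

Section Psi_kernel.
Context {R : realType}.
Implicit Types (q beta B c x y : R).
Local Notation mu := (@lebesgue_measure R).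

Lemma cvg_expR_Ny {T : Type} {F : set_system T} {FF : Filter F}
    (K : R) (f : T -> R) :
  f x @[x --> F] --> -oo%R -> K * expR (f x) @[x --> F] --> 0.
Proof.
move=> fNy; rewrite -(mulr0 K); apply: cvgM; first exact: cvg_cst.
have -> : (fun x : T => expR (f x)) =
    (fun t => expR (- t)) \o (fun x : T => - f x).
  by apply/funext => x /=; rewrite opprK.
apply: cvg_comp; last exact: cvgr_expR.
exact/cvgNry.
Qed.

Lemma Psi_primitive_cvgNy c q : 0 < c -> 0 < q ->
  Psi_primitive c q x @[x --> -oo%R] --> 0.
Proof.
move=> c0 q0.
apply: (@squeeze_cvgr _ _ _ _ (cst 0)
  (fun x => (q + q^-1) / 2 * expR (c * (x + 1)))).
- by near=> x; rewrite Psi_primitive_ge0//= Psi_primitive_le.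
- exact: cvg_cst.
- apply: cvg_expR_Ny; apply/cvgrNyPle => A; near=> x.
  have : x <= A / c - 1 by near: x; apply: nbhs_ninfty_le; rewrite num_real.
  by rewrite lerBrDr ler_pdivlMr// mulrC.
Unshelve. all: by end_near. Qed.

Lemma Psi_primitive_cvgy c q : 0 < c -> 0 < q ->
  Psi_primitive c q x @[x --> +oo%R] --> (1 : R).
Proof.
move=> c0 q0.
apply: (@squeeze_cvgr _ _ _ _
  (fun x => 1 - (q + q^-1) / 2 * expR (- (c * (x - 1)))) (cst 1)); last 2 first.
- rewrite -[X in _ --> X]subr0; apply: cvgB; first exact: cvg_cst.
  apply: cvg_expR_Ny; apply/cvgrNyPle => A; near=> x.
  have : - A / c + 1 <= x by near: x; apply: nbhs_pinfty_ge; rewrite num_real.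
  by rewrite -lerBrDr ler_pdivrMr// mulrC; lra.
- exact: cvg_cst.
near=> x; rewrite /= Psi_primitive_le1// andbT.
by have := Psi_primitive_ge c q x c0 q0; lra.
Unshelve. all: by end_near. Qed.

Lemma is_derive_Psi_kernel q beta B y v : 0 < q -> 0 < beta -> 1 < B ->
  is_derive v (1 : R) (fun v => - Psi_primitive (beta * ln B) q (y - v))
    (Psi q beta B (y - v)).
Proof.
move=> q0 b0 B1.
have d := is_derive_Psi_primitive q beta B (y - v) q0 b0 B1.
have dB : is_derive v (1 : R) (fun v => y - v) (- 1).
  by apply: is_derive_eq; rewrite add0r mul1r.
have dC := @is_derive1_comp _ (Psi_primitive (beta * ln B) q) (fun v => y - v)
  v _ _ d dB.
by apply: is_derive_eq; rewrite mulrN1 opprK.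
Qed.

Lemma Psi_kernel_continuous q beta B y : 0 < q -> 0 < B ->
  continuous (fun v => Psi q beta B (y - v)).
Proof.
move=> q0 B0 v; apply: (@continuous_comp _ _ _ (fun v => y - v));
  last exact: Psi_continuous.
by apply: cvgB; [exact: cvg_cst|exact: cvg_id].
Qed.

(** As v tends to +oo, y - v tends to -oo, where the distribution function vanishes; only the
    endpoint b contributes. *)
Lemma integral_Psi_kernel_y q beta B y b : 0 < q -> 0 < beta -> 1 < B ->
  (\int[mu]_(v in `[b, +oo[) (Psi q beta B (y - v))%:E =
   (Psi_primitive (beta * ln B) q (y - b))%:E)%E.
Proof.
move=> q0 b0 B1; have c0 : 0 < beta * ln B by rewrite mulr_gt0 ?ln_gt0.
have B0 : 0 < B by exact: lt_trans B1.
have -> : Psi_primitive (beta * ln B) q (y - b) =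
    0 - - Psi_primitive (beta * ln B) q (y - b) by rewrite sub0r opprK.
apply: (ge0_integral_primitivey (fun v => Psi q beta B (y - v))
  (fun v => - Psi_primitive (beta * ln B) q (y - v)) b 0).
- by move=> v; exact: Psi_ge0.
- exact: Psi_kernel_continuous.
- by move=> v; exact: is_derive_Psi_kernel.
rewrite -oppr0; apply: cvgN.
have h := Psi_primitive_cvgNy _ _ c0 q0.
apply: (@cvg_comp _ _ _ (fun v => y - v)
  (Psi_primitive (beta * ln B) q) _ _ _ _ h).
apply/cvgrNyPle => A; near=> x.
have : y - A <= x by near: x; apply: nbhs_pinfty_ge; rewrite num_real.
lra.
Unshelve. all: by end_near. Qed.

Lemma integral_Psi_kernel_Ny q beta B y a : 0 < q -> 0 < beta -> 1 < B ->
  (\int[mu]_(v in `]-oo, a]) (Psi q beta B (y - v))%:E =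
   (1 - Psi_primitive (beta * ln B) q (y - a))%:E)%E.
Proof.
move=> q0 b0 B1; have c0 : 0 < beta * ln B by rewrite mulr_gt0 ?ln_gt0.
have B0 : 0 < B by exact: lt_trans B1.
have -> : 1 - Psi_primitive (beta * ln B) q (y - a) =
    - Psi_primitive (beta * ln B) q (y - a) - (-1) by rewrite opprK addrC.
apply: (ge0_integral_primitiveNy (fun v => Psi q beta B (y - v))
  (fun v => - Psi_primitive (beta * ln B) q (y - v)) a (-1)).
- by move=> v; exact: Psi_ge0.
- exact: Psi_kernel_continuous.
- by move=> v; exact: is_derive_Psi_kernel.
apply: cvgN.
have h := Psi_primitive_cvgy _ _ c0 q0.
apply: (@cvg_comp _ _ _ (fun v => y - v)
  (Psi_primitive (beta * ln B) q) _ _ _ _ h).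
apply/cvgryPge => A; near=> x.
have : x <= y - A by near: x; apply: nbhs_ninfty_le; rewrite num_real.
lra.
Unshelve. all: by end_near. Qed.

(** Cutting the line at 0 gives the masses 1 - P(y) and P(y), where P is [Psi_primitive]. *)
Lemma integral_Psi_kernel q beta B y : 0 < q -> 0 < beta -> 1 < B ->
  (\int[mu]_v (Psi q beta B (y - v))%:E = 1)%E.
Proof.
move=> q0 b0 B1; have B0 : 0 < B by exact: lt_trans B1.
have mg : measurable_fun [set: R] (fun v => Psi q beta B (y - v)).
  by apply: continuous_measurable_fun; exact: Psi_kernel_continuous.
have -> : [set: R] = `]-oo, 0%R] `|` `]0%R, +oo[.
  by rewrite -itv_bndbnd_setU// set_itvNyy.
rewrite ge0_integral_setU//; last 3 first.
- by apply/measurable_EFinP; exact: measurable_funTS.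
- by move=> v _; rewrite lee_fin Psi_ge0.
- apply/disj_setPS => v [/=]; rewrite !in_itv/= andbT => v0 v1.
  by move: (lt_le_trans v1 v0); rewrite ltxx.
(* The right piece was taken open for disjointness; adding its endpoint does not change the
   integral. *)
rewrite integral_itv_obnd_cbnd; last first.
  by apply/measurable_EFinP; exact: measurable_funTS.
rewrite integral_Psi_kernel_Ny// integral_Psi_kernel_y//.
by rewrite -EFinD subrK.
Qed.

Lemma integrable_Psi_kernel q beta B y : 0 < q -> 0 < beta -> 1 < B ->
  mu.-integrable setT (EFin \o (fun v => Psi q beta B (y - v))).
Proof.
move=> q0 b0 B1; have B0 : 0 < B by exact: lt_trans B1.
apply/integrableP; split.
  apply/measurable_EFinP.
  by apply: continuous_measurable_fun; exact: Psi_kernel_continuous.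
under eq_integral do rewrite gee0_abs ?lee_fin ?Psi_ge0//.
by rewrite integral_Psi_kernel// ltry.
Qed.

End Psi_kernel.

(** * Moving integrals and averages against a density *)

Section Approximation.
Context {R : realType}.
Local Notation mu := (@lebesgue_measure R).
Implicit Types (f g F : R -> R).

Lemma continuous_integrable_itv f (a b : R) : continuous f ->
  mu.-integrable `[a, b] (EFin \o f).
Proof.
move=> cf; apply: continuous_compact_integrable; first exact: segment_compact.
exact: continuous_subspaceT.
Qed.

(** Near s0 the moving integral is [I (s + r) - I s], with [I] the integral from the fixed base
    point s0 - 1. The margins of 1 keep s0 and s0 + r interior, where [I] is continuous. This yields
    the measurability of the inner average of the operator. *)
Lemma moving_integral_continuous f (r : R) : 0 <= r -> continuous f ->
  continuous (fun s => \int[mu]_(h in `[s, s + r]) f h).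
Proof.
move=> r0 cf s0.
pose I s := \int[mu]_(h in `[s0 - 1, s]) f h.
have ab : s0 - 1 < s0 + r + 1 by lra.
have cI s : s0 - 1 < s -> s < s0 + r + 1 -> {for s, continuous I}.
  move=> h1 h2.
  apply: (@within_continuous_continuous R R R _ _ I s ab); last first.
    by rewrite in_itv/= h1.
  apply: parameterized_integral_continuous; first exact: ltW.
  exact: continuous_integrable_itv.
have E : \forall s \near s0, I (s + r) - I s = \int[mu]_(h in `[s, s + r]) f h.
  near=> s; have sa : s0 - 1 <= s.
    by apply: ltW; near: s; apply: lt_nbhsr; lra.
  rewrite /I Rintegral_itvB ?bnd_simp//; last by lra.
    rewrite Rintegral_itv_obnd_cbnd//.
    apply: integrableS (continuous_integrable_itv _ s (s + r) cf) => //.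
    by apply: subset_itvr; rewrite bnd_simp.
  exact: continuous_integrable_itv.
have E0 := nbhs_singleton E.
rewrite /continuous_at -E0.
apply: cvg_trans; first by apply: near_eq_cvg; exact: E.
apply: cvgB; last by apply: cI; lra.
apply: (@continuous_comp _ _ _ (fun s => s + r) I); last by apply: cI; lra.
by apply: cvgD; [exact: cvg_id|exact: cvg_cst].
Unshelve. all: by end_near. Qed.

(** The constant y is written as an integral over the same interval. Keeping the factor b - a
    instead of dividing by it covers a = b as well. *)
Lemma Rintegral_itv_dist f (a b y w : R) : continuous f -> a <= b ->
    (forall h, a <= h <= b -> `|f h - y| <= w) ->
  `|\int[mu]_(h in `[a, b]) f h - y * (b - a)| <= w * (b - a).
Proof.
move=> cf ab fw.
have mab : (mu `[a, b] = (b - a)%:E)%E.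
  rewrite lebesgue_measure_itv/= lte_fin.
  by case: ltgtP ab => // [-> _]; rewrite subrr.
have cst_int k : \int[mu]_(h in `[a, b]) k = k * (b - a).
  rewrite Rintegral_cst//; congr (_ * _). apply: (congr1 fine mab).
have fi := continuous_integrable_itv _ a b cf.
have ci (k : R) : mu.-integrable `[a, b] (EFin \o (fun=> k)).
  by apply: continuous_integrable_itv => z; exact: cvg_cst.
have iD : mu.-integrable `[a, b] (EFin \o (fun h => f h - y)).
  by apply: continuous_integrable_itv => z;
    apply: cvgB; [exact: cf|exact: cvg_cst].
rewrite -!cst_int -RintegralB//.
apply: (le_trans (le_normr_Rintegral _ iD)) => //.
apply: le_Rintegral => //.
exact: (integrable_norm iD).
Qed.

Lemma weighted_integrable F g (y w : R) : (forall v, 0 <= g v) ->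
    mu.-integrable setT (EFin \o g) -> measurable_fun setT F ->
    (forall v, `|F v - y| <= w) ->
  mu.-integrable setT (EFin \o (fun v => F v * g v)).
Proof.
move=> g0 ig mF Fw; have bF : [bounded F x | x in [set: R]]; last first.
  by have := @integrableMr _ _ _ mu _ measurableT F _ mF bF ig; exact.
exists (w + `|y|); split; first exact: num_real.
move=> M /ltW wM v _ /=; apply: le_trans wM.
by rewrite -[F v](subrK y) (le_trans (ler_normD _ _))// lerD2r.
Qed.

(** Since g has mass 1, y is the integral of y g, so the difference is the integral of (F - y) g.
    The set A is where an extra error K is allowed, and it costs only the g-mass of A. *)
Lemma weighted_dist F g (A : set R) (y w K : R) : (forall v, 0 <= g v) ->
    mu.-integrable setT (EFin \o g) -> \int[mu]_v g v = 1 ->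
    measurable_fun setT F -> measurable A -> 0 <= K ->
    (forall v, `|F v - y| <= w + K * \1_A v) ->
  `|\int[mu]_v (F v * g v) - y| <= w + K * \int[mu]_(v in A) g v.
Proof.
move=> g0 ig g1 mF mA K0 Fw.
have Fb v : `|F v - y| <= w + K.
  by apply: le_trans (Fw v) _; rewrite lerD2l ler_piMr.
have iFg := weighted_integrable _ _ _ _ g0 ig mF Fb.
have iZ k : mu.-integrable setT (EFin \o (fun v => k * g v)).
  by have := integrableZl measurableT k ig; exact.
(* Extending g by zero outside A lets both terms of the bound be integrated over the whole line. *)
have igA : mu.-integrable setT (EFin \o (g \_ A)).
  rewrite -restrict_EFin; apply/integrable_restrict => //.
  by rewrite setTI; apply: integrableS ig.
have iZA : mu.-integrable setT (EFin \o (fun v => K * (g \_ A) v)).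
  by have := integrableZl measurableT K igA; exact.
have iD : mu.-integrable setT (EFin \o (fun v => F v * g v - y * g v)).
  by have := integrableB measurableT iFg (iZ y); exact.
have -> : \int[mu]_v (F v * g v) - y = \int[mu]_v (F v * g v - y * g v).
  by rewrite RintegralB// RintegralZl// g1 mulr1.
apply: (le_trans (le_normr_Rintegral _ iD)); first exact: measurableT.
have -> : w + K * \int[mu]_(v in A) g v =
    \int[mu]_v (w * g v + K * (g \_ A) v).
  by rewrite RintegralD// !RintegralZl// g1 mulr1 -Rintegral_mkcond.
apply: le_Rintegral => //.
- exact: (integrable_norm iD).
- by have := integrableD measurableT (iZ w) iZA; exact.
move=> v _; rewrite -mulrBl normrM (ger0_norm (g0 v)).
apply: le_trans (ler_wpM2r (g0 v) (Fw v)) _.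
rewrite mulrDl lerD2l -mulrA ler_wpM2l// patchE indicE.
by case: (v \in A); rewrite ?mul1r ?mul0r.
Qed.

End Approximation.

(** * Error bounds for the Kantorovich operator *)

Section Estimate.
Context {R : realType}.
Implicit Types (q beta B : R) (f : R -> R).
Local Notation mu := (@lebesgue_measure R).

(** The two tails have masses 1 - P(N) and P(-N), with P the distribution function; each is at most
    half of the right-hand side. *)
Lemma Psi_kernel_tails q beta B (y N : R) :
    0 < q -> 0 < beta -> 1 < B -> 0 < N ->
  \int[mu]_(v in `]-oo, (y - N)%R] `|` `[(y + N)%R, +oo[) Psi q beta B (y - v)
    <= (q + q^-1) * expR (- (beta * ln B * (N - 1))).
Proof.
move=> q0 b0 B1 N0; have B0 : 0 < B by exact: lt_trans B1.
have c0 : 0 < beta * ln B by rewrite mulr_gt0 ?ln_gt0.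
rewrite /Rintegral ge0_integral_setU//; last 3 first.
- apply/measurable_EFinP; apply: measurable_funTS.
  by apply: continuous_measurable_fun; exact: Psi_kernel_continuous.
- by move=> v _; rewrite lee_fin Psi_ge0.
- apply/disj_setPS => v [/=]; rewrite !in_itv/= andbT => v0 v1; lra.
rewrite integral_Psi_kernel_Ny// integral_Psi_kernel_y// -EFinD /=.
rewrite subKr opprD addNKr.
have := Psi_primitive_le (beta * ln B) q (- N) c0 q0.
have := Psi_primitive_ge (beta * ln B) q N c0 q0.
have -> : beta * ln B * (- N + 1) = - (beta * ln B * (N - 1)) by ring.
lra.
Qed.

(** The cutoff N, the oscillation bound w and the bound M stay free, so that the same estimate
    serves both the explicit bound and the limit. *)
Lemma Kantorovich_dist q beta B n f (x N w M : R) :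
    0 < q -> 0 < beta -> 1 < B -> (0 < n)%N -> 0 < N -> continuous f ->
    (forall h, `|f h| <= M) ->
    (forall h, `|h - x| <= n%:R^-1 + N / n%:R -> `|f h - f x| <= w) ->
  `|Kantorovich q beta B n f x - f x| <=
    w + 2 * M * ((q + q^-1) * expR (- (beta * ln B * (N - 1)))).
Proof.
move=> q0 b0 B1 n0 N0 cf fM fw; have B0 : 0 < B by exact: lt_trans B1.
have nR : 0 < n%:R :> R by rewrite ltr0n.
have M0 : 0 <= M by exact: le_trans (fM x).
have w0 : 0 <= w.
  have := fw x; rewrite !subrr normr0; apply.
  by rewrite addr_ge0 ?invr_ge0 ?divr_ge0 ?ltW.
(* [F v] is the mean of f over an interval of length 1/n, [g] the density, and [A] the tail set |nx
   - v| >= N. *)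
pose J v := \int[mu]_(h in `[v / n%:R, (v + 1) / n%:R]) f h.
pose F v := n%:R * J v.
pose g v := Psi q beta B (n%:R * x - v).
pose A : set R := `]-oo, (n%:R * x - N)%R] `|` `[(n%:R * x + N)%R, +oo[.
have cJ : continuous J.
  pose I s := \int[mu]_(h in `[s, s + n%:R^-1]) f h.
  have -> : J = I \o (fun v => v / n%:R).
    by apply/funext => v; rewrite /J /I /= mulrDl mul1r.
  move=> v; apply: (@continuous_comp R R R (fun v => v / n%:R) I).
    by apply: cvgM; [exact: cvg_id|exact: cvg_cst].
  by apply: moving_integral_continuous => //; rewrite invr_ge0 ltW.
have mF : measurable_fun [set: R] F.
  by apply: continuous_measurable_fun => v;
    apply: cvgM; [exact: cvg_cst|exact: cJ].
have g0 v : 0 <= g v by exact: Psi_ge0.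
have ig := integrable_Psi_kernel q beta B (n%:R * x) q0 b0 B1.
have g1 : \int[mu]_v g v = 1 by rewrite /Rintegral integral_Psi_kernel.
have mA : measurable A by apply: measurableU; exact: measurable_itv.
have Fdist v e :
    (forall h, v / n%:R <= h <= (v + 1) / n%:R -> `|f h - f x| <= e) ->
    `|F v - f x| <= e.
  move=> fe; have ab : v / n%:R <= (v + 1) / n%:R.
    by rewrite ler_pM2r ?invr_gt0// lerDl.
  have := Rintegral_itv_dist f _ _ (f x) e cf ab fe.
  have -> : (v + 1) / n%:R - v / n%:R = n%:R^-1 by ring.
  rewrite -(ler_pM2l nR) -{1}(gtr0_norm nR) -normrM mulrBr.
  by rewrite !(mulrCA n%:R) mulfV ?gt_eqF// !mulr1.
have FA v : `|F v - f x| <= w + (2 * M) * \1_A v.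
  apply: Fdist => h /andP[h1 h2]; rewrite indicE.
  have [vA|vA] := boolP (v \in A).
    rewrite mulr1; apply: le_trans (ler_normB _ _) _.
    by have := fM h; have := fM x; lra.
  rewrite mulr0 addr0; apply: fw.
  (* Off [A], |v - nx| < N while nh lies between v and v + 1, so |nh - nx| <= N + 1; dividing by n
     gives the window 1/n + N/n. *)
  move: vA; rewrite notin_setE /A /= !in_itv/= andbT => /not_orP[/negP + /negP].
  rewrite -!ltNge => v1 v2.
  rewrite ler_pdivrMr// in h1; rewrite ler_pdivlMr// in h2.
  rewrite -(ler_pM2r nR) mulrDl divfK ?gt_eqF// mulVf ?gt_eqF//.
  rewrite -[X in _ * X](gtr0_norm nR) -normrM ler_norml; lra.
have Fb v : `|F v - f x| <= w + 2 * M.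
  by apply: le_trans (FA v) _; rewrite lerD2l ler_piMr ?mulr_ge0.
have iFg := weighted_integrable F g (f x) (w + 2 * M) g0 ig mF Fb.
have -> : Kantorovich q beta B n f x = \int[mu]_v (F v * g v).
  (* Integrability is known for [F v * g v], so the integrand is first written as a multiple of it,
     and the constant is then pulled out. *)
  have -> : Kantorovich q beta B n f x =
      n%:R * \int[mu]_v (n%:R^-1 * (F v * g v)).
    congr (_ * _); apply: eq_Rintegral => v _.
    by rewrite /F -mulrA mulKf// gt_eqF.
  by rewrite RintegralZl// mulVKf// gt_eqF.
apply: le_trans (weighted_dist F g A (f x) w (2 * M) g0 ig g1 mF mA _ FA) _.
  by rewrite mulr_ge0.
by rewrite lerD2l ler_wpM2l ?mulr_ge0//; exact: Psi_kernel_tails.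
Qed.

Lemma unif_continuous_dist f (e : R) : unif_continuous f -> 0 < e ->
  exists2 d, 0 < d & forall x y, `|x - y| < d -> `|f x - f y| < e.
Proof.
move=> /unif_continuousP/[apply] -[d d0 fd]; exists d => // x y.
exact: (fd (x, y)).
Qed.

Lemma unif_continuous_continuous f : unif_continuous f -> continuous f.
Proof.
move=> uf x; apply/cvgrPdist_lt => e /(unif_continuous_dist _ _ uf)[d d0 fd].
by near=> y; apply: fd; near: y; apply: cvgr_dist_lt => //; exact: cvg_id.
Unshelve. all: by end_near. Qed.

(** With N = nd/2 the window 1/n + N/n is 1/n + d/2, below the continuity threshold d for large n,
    while N tends to infinity and kills the tail. Nothing in the choice of n depends on x. *)
Lemma near_Kantorovich_dist q beta B f (e : R) :
    0 < q -> 0 < beta -> 1 < B -> C_UB f -> 0 < e ->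
  \forall n \near \oo, forall x, `|Kantorovich q beta B n f x - f x| < e.
Proof.
move=> q0 b0 B1 [uf [M [_ bf]]] e0.
have c0 : 0 < beta * ln B by rewrite mulr_gt0 ?ln_gt0.
(* Boundedness provides a bound only by numbers strictly above [M]. *)
have fM h : `|f h| <= M + 1 by apply: bf => //; rewrite ltrDl.
have cf := unif_continuous_continuous f uf.
have e4 : 0 < e / 4 by rewrite divr_gt0.
have [d d0 fd] := unif_continuous_dist f _ uf e4.
have tail : (2 * (M + 1) * (q + q^-1)) *
    expR (- (beta * ln B * (n%:R * (d / 2) - 1))) @[n --> \oo] --> (0 : R).
  apply: cvg_expR_Ny; apply/cvgrNyPle => a; near=> n.
  have : (1 - a / (beta * ln B)) / (d / 2) <= n%:R.
    by near: n; exact: nbhs_infty_ger.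
  rewrite ler_pdivrMr ?divr_gt0// => h.
  have : - a / (beta * ln B) <= n%:R * (d / 2) - 1 by lra.
  by rewrite ler_pdivrMr// mulrC; lra.
near=> n => x.
have n0 : (0 < n)%N by near: n; exact: nbhs_infty_gt.
have nR : 0 < n%:R :> R by rewrite ltr0n.
have nd : n%:R^-1 < d / 2.
  rewrite -[ltRHS]invrK ltf_pV2 ?posrE ?invr_gt0 ?divr_gt0//.
  by near: n; exact: nbhs_infty_gtr.
(* One quarter is for the oscillation and one for the tail; their sum stays strictly below e. *)
apply: (@le_lt_trans _ _ (e / 4 + e / 4)); last by lra.
have N0 : 0 < n%:R * (d / 2) by rewrite mulr_gt0 ?divr_gt0.
apply: le_trans (Kantorovich_dist q beta B n f x _ (e / 4) (M + 1)
  q0 b0 B1 n0 N0 cf fM _) _.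
  move=> h; rewrite mulrAC mulfV ?gt_eqF// mul1r => hx.
  by apply/ltW/fd; lra.
rewrite lerD2l mulrA; apply: le_trans (ler_norm _) _; rewrite -normrN -sub0r.
near: n; move/cvgrPdist_le : tail; exact.
Unshelve. all: by end_near. Qed.

(** Boundedness excludes the default value 0 of [sup], making the supremum a genuine upper bound. *)
Lemma normr_le_supnorm f (h : R) : bounded_fun f -> `|f h| <= supnorm f.
Proof.
move=> [M [_ bf]]; apply: ub_le_sup; last by exists h.
by exists (M + 1) => _ [z _ <-]; apply: bf => //; rewrite ltrDl.
Qed.

Lemma dist_le_modulus f (theta x y : R) : bounded_fun f ->
  `|x - y| <= theta -> `|f x - f y| <= modulus f theta.
Proof.
move=> bf xy; apply: ub_le_sup; last by exists x, y.
exists (supnorm f + supnorm f) => _ [u [v [_ ->]]].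
by rewrite (le_trans (ler_normB _ _))// lerD// normr_le_supnorm.
Qed.

End Estimate.

Theorem theorem3 (R : realType) (q beta B : R)
    (q_gt0 : 0 < q) (beta_gt0 : 0 < beta) (B_gt1 : 1 < B) :
  (forall (alpha : R) (n : nat) (f : R -> R),
     0 < alpha -> alpha < 1 -> (0 < n)%N -> 2 < n%:R `^ (1 - alpha) ->
     C_B f ->
     let E := modulus f (n%:R^-1 + (n%:R `^ alpha)^-1)
              + 2 * (q + q^-1) * supnorm f
                / B `^ (beta * (n%:R `^ (1 - alpha) - 1)) in
     (forall x : R, `|Kantorovich q beta B n f x - f x| <= E) /\
     supnorm (fun x => Kantorovich q beta B n f x - f x) <= E) /\
  (forall f : R -> R, C_UB f ->
     (forall x : R, Kantorovich q beta B n f x @[n --> \oo] --> f x) /\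
     {uniform, (fun n : nat => Kantorovich q beta B n f) @ \oo --> f}).
Proof.
split=> [alpha n f _ _ n_gt0 n2 [cf bf] E|f Cf].
  have KE x : `|Kantorovich q beta B n f x - f x| <= E.
    have n0 : (0 : R) < n%:R by rewrite ltr0n.
    have N0 : 0 < n%:R `^ (1 - alpha) by exact: lt_trans n2.
    (* The cutoff N = n^(1 - alpha) makes N/n the second term in the argument of the modulus. *)
    have NE : n%:R `^ (1 - alpha) / n%:R = (n%:R `^ alpha)^-1.
      rewrite powRD; last by apply/implyP => _; rewrite gt_eqF.
      by rewrite powRr1 ?ltW// mulrAC mulfV ?gt_eqF// mul1r powRN.
    have := Kantorovich_dist q beta B n f x _
      (modulus f (n%:R^-1 + (n%:R `^ alpha)^-1))
      (supnorm f) q_gt0 beta_gt0 B_gt1 n_gt0 N0 cf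
      (fun h => normr_le_supnorm f h bf).
    rewrite NE => /(_ (fun h => dist_le_modulus f _ h x bf)).
    move=> /le_trans; apply.
    rewrite lerD2l [B `^ _]powR_expR; last exact: lt_trans B_gt1.
    by rewrite -expRN [beta * _ * _]mulrAC; lra.
  (* Bounding the supremum by [E] also requires a nonempty set; the point 0 supplies an element. *)
  split=> //; apply: ge_sup; last by move=> _ [x _ <-].
  by exists `|Kantorovich q beta B n f 0 - f 0|, 0.
have nK e : 0 < e -> _ :=
  near_Kantorovich_dist q beta B f e q_gt0 beta_gt0 B_gt1 Cf.
split=> [x|P /uniform_nbhs[V [/=]]].
  by apply/cvgrPdist_lt => e /nK; apply: filterS => n /(_ x); rewrite distrC.
(* The entourage contains the pairs at distance below some e, and [nK] gives this distance for all x
   at once. *)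
rewrite -entourage_ballE => -[e /= /nK Ke eV] VP; apply: filterS Ke => n Ke.
by apply: VP => x _; apply: eV; rewrite /ball /= distrC.
Qed.
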